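(* Let $A=\{x_1,x_2\}$ be an alphabet of two variables and let $x$ be a further variable. For every positive integer $n$, $$\sum_{k=0}^{n}\binom{n}{k}(x_1-x_2)^{n-k-1}\left(2^k\phi_k(x_1+x_2)-2(x_1+x_2)^k\right)B_{n-k}(x)=n\left(\bigl(x_1+x_2+(x_1-x_2)x\bigr)^{n-1}-\bigl((x_1-x_2)x+2x_2\bigr)^{n-1}\right).$$
   Context: Here $x_1,x_2,x$ are commuting variables (indeterminates) and identities are in the field of rational functions in them. The notation $\phi_n(x_1+x_2)$ denotes the function of the alphabet $\{x_1,x_2\}$ (not of the sum) given by $\phi_n(x_1+x_2)=x_1^n+x_2^n$ for $n\ge 0$; the expression $(x_1+x_2)^k$ is the ordinary power of the sum. The Bernoulli polynomials $B_n(x)$ are defined by $\sum_{n\ge 0}B_n(x)\frac{z^n}{n!}=\frac{ze^{xz}}{e^z-1}$. *)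

(* Defs.v *)
From mathcomp Require Import all_boot all_order all_algebra.
From mathcomp Require Import mpoly.

Set Implicit Arguments.
Unset Strict Implicit.
Unset Printing Implicit Defensive.

Import GRing.Theory.
Local Open Scope ring_scope.

(** Formal power series in z are represented by their coefficient sequences:
    [a : nat -> R] stands for [\sum_n a n * z ^ n]. *)

Section FormalPowerSeries.
Variable R : comUnitRingType.
Implicit Types a b : nat -> R.

Definition fps_mul a b : nat -> R :=
  fun n => \sum_(i < n.+1) a i * b (n - i)%N.

(** [fps_inv_seq a n] lists the coefficients 0, ..., n of the inverse [b] of
    [a], computed from [a 0 * b n = - \sum_(i < n) a (n - i) * b i]. *)
Fixpoint fps_inv_seq a (n : nat) : seq R :=
  match n with
  | 0 => [:: (a 0%N)^-1]
  | m.+1 =>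
      let s := fps_inv_seq a m in
      rcons s (- (a 0%N)^-1 * \sum_(i < m.+1) a (m.+1 - i)%N * s`_i)
  end.

Definition fps_inv a : nat -> R := fun n => (fps_inv_seq a n)`_n.

(** The series e^(cz). *)
Definition fps_exp (c : R) : nat -> R := fun n => c ^+ n / n`!%:R.

Definition fps_one : nat -> R := fun n => (n == 0%N)%:R.

Definition fps_sub a b : nat -> R := fun n => a n - b n.

(** Multiplication and exact division by z (the latter drops [a 0]). *)
Definition fps_mulz a : nat -> R := fun n => if n is m.+1 then a m else 0.
Definition fps_divz a : nat -> R := fun n => a n.+1.

End FormalPowerSeries.

Section Bernoulli.
Variable K : fieldType.

(** z e^(xz) / (e^z - 1) over K[x]. As e^z - 1 has no constant term, the
    quotient is computed as e^(xz) times the inverse of (e^z - 1) / z, whose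
    constant term is 1; [bernoulli_genE] is the resulting identity. *)
Definition bernoulli_gen : nat -> {poly K} :=
  fps_mul (fps_exp 'X)
    (fps_inv (fps_divz (fps_sub (fps_exp 1) (@fps_one {poly K})))).

(** Meaningful when K has characteristic 0. *)
Definition bernoulli (n : nat) : {poly K} := n`!%:R * bernoulli_gen n.

End Bernoulli.

Section Facts.

Lemma size_fps_inv_seq (R : comUnitRingType) (a : nat -> R) n :
  size (fps_inv_seq a n) = n.+1.
Proof. by elim: n => //= n IHn; rewrite size_rcons IHn. Qed.

Lemma nth_fps_inv_seq (R : comUnitRingType) (a : nat -> R) n i :
  (i <= n)%N -> (fps_inv_seq a n)`_i = fps_inv a i.
Proof.
elim: n => [|n IHn]; first by case: i.
rewrite leq_eqVlt => /predU1P[-> //|lt_in].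
by rewrite /= nth_rcons size_fps_inv_seq lt_in IHn.
Qed.

Lemma fps_invS (R : comUnitRingType) (a : nat -> R) n :
  fps_inv a n.+1 =
  - (a 0%N)^-1 * \sum_(i < n.+1) a (n.+1 - i)%N * fps_inv a i.
Proof.
rewrite {1}/fps_inv /= nth_rcons size_fps_inv_seq ltnn eqxx.
congr (_ * _); apply: eq_bigr => i _.
by rewrite nth_fps_inv_seq // -ltnS.
Qed.

Lemma fps_mulC (R : comUnitRingType) (a b : nat -> R) n :
  fps_mul a b n = fps_mul b a n.
Proof.
rewrite /fps_mul (reindex_inj rev_ord_inj) /=; apply: eq_bigr => i _.
by rewrite mulrC subSS subKn // -ltnS.
Qed.

Lemma fps_mulVr (R : comUnitRingType) (a : nat -> R) n :
  a 0%N \is a GRing.unit -> fps_mul (fps_inv a) a n = fps_one R n.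
Proof.
move=> ua; rewrite /fps_mul /fps_one; case: n => [|n].
  by rewrite big_ord1 /fps_inv /= mulVr.
rewrite big_ord_recr /= subnn fps_invS mulNr mulNr mulrAC mulVr // mul1r.
by apply/eqP; rewrite subr_eq0; apply/eqP/eq_bigr => i _; rewrite mulrC.
Qed.

Lemma fps_mulA (R : comUnitRingType) (a b c : nat -> R) n :
  fps_mul a (fps_mul b c) n = fps_mul (fps_mul a b) c n.
Proof.
pose P (f : nat -> R) := \poly_(i < n.+1) f i.
have PE f g m : (m <= n)%N -> fps_mul f g m = (P f * P g)`_m.
  move=> le_mn; rewrite coefM; apply: eq_bigr => i _.
  by rewrite !coef_poly !ltnS (leq_trans (leq_subr _ _)) //
             (leq_trans _ le_mn) // -ltnS.
have -> : fps_mul a (fps_mul b c) n = (P a * (P b * P c))`_n.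
  rewrite coefM; apply: eq_bigr => i _.
  by rewrite coef_poly ltn_ord PE ?leq_subr.
rewrite mulrA coefM; apply: eq_bigr => i _.
by rewrite PE -1?ltnS // coef_poly ltnS leq_subr.
Qed.

(** The generating function identity defining the Bernoulli polynomials:
    (e^z - 1) * \sum_n B_n(x) z^n / n! = z e^(xz). *)
Lemma bernoulli_genE (K : fieldType) (charK0 : [pchar K] =i pred0) (n : nat) :
  fps_mul (fps_sub (fps_exp 1) (@fps_one {poly K}))
          (fun m => bernoulli K m / m`!%:R) n
  = fps_mulz (fps_exp 'X) n.
Proof.
pose d := fps_sub (fps_exp 1) (@fps_one {poly K}).
have uf m : (m`!%:R : {poly K}) \is a GRing.unit.
  rewrite -polyC_natr poly_unitE size_polyC coefC /= unitfE.
  suff -> : (m`!%:R : K) != 0 by [].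
  by rewrite ((pcharf0P K).1 charK0) -lt0n fact_gt0.
have d0 : d 0%N = 0 by rewrite /d /fps_sub /fps_exp /fps_one expr0 divr1 subrr.
have u0 : fps_divz d 0%N \is a GRing.unit.
  by rewrite /fps_divz /d /fps_sub /fps_exp /fps_one expr1n divr1 subr0 unitr1.
case: n => [|n]; first by rewrite /fps_mul big_ord1 -/d d0 mul0r.
rewrite /fps_mul big_ord_recl -/d d0 mul0r add0r /=.
transitivity (fps_mul (fps_divz d) (bernoulli_gen K) n).
  apply: eq_bigr => i _; rewrite /bump /= add1n subSS; congr (_ * _).
  by rewrite /bernoulli mulrAC mulrV // mul1r.
rewrite fps_mulC -fps_mulA /fps_mul (bigD1 ord_max) //= subnn.
rewrite -[X in _ * X + _]/(fps_mul (fps_inv (fps_divz d)) (fps_divz d) 0).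
rewrite fps_mulVr // mulr1 big1 ?addr0 // => i ne_in.
rewrite -[X in _ * X]/(fps_mul (fps_inv (fps_divz d)) (fps_divz d) (n - i)).
have lt_in : (i < n)%N by rewrite ltn_neqAle -ltnS ltn_ord andbT; exact: ne_in.
by rewrite fps_mulVr // /fps_one subn_eq0 leqNgt lt_in mulr0.
Qed.

End Facts.

(** The alphabet {x1, x2}, also written x1 + x2 in lambda-ring notation, is the
    sequence [:: x1; x2]. *)
Definition phi (R : pzSemiRingType) (n : nat) (A : seq R) : R :=
  \sum_(a <- A) a ^+ n.

(** The field of rational functions in three indeterminates over K. *)
Notation ratfun3 K := {fraction {mpoly K[3]}}.

Definition ratfunC (K : fieldType) (c : K) : ratfun3 K := tofrac c%:MP_[3].
Definition ratfunX (K : fieldType) (i : 'I_3) : ratfun3 K := tofrac ('X_i : {mpoly K[3]}).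

(* Main.v *)
(** Write d = x1 - x2. The exponential generating function of
    2^k phi_k(x1 + x2) - 2 (x1 + x2)^k is
    e^(2 x2 z) (e^(dz) - 1)^2, and that of d^m B_m(x) is
    dz e^(dxz) / (e^(dz) - 1). Their product is
    d z (e^((x1 + x2 + dx) z) - e^((2 x2 + dx) z)), whose coefficients are d
    times the right-hand side. *)
From HB Require Import structures.
Require Import Defs.
From mathcomp Require Import all_boot all_order all_algebra.
From mathcomp Require Import mpoly.
From mathcomp Require Import ring.

Set Implicit Arguments.
Unset Strict Implicit.
Unset Printing Implicit Defensive.

Import GRing.Theory.
Local Open Scope ring_scope.

Section FpsMul.
Variable R : comUnitRingType.
Implicit Types a b c : nat -> R.

Lemma eq_fps_mul a a' b b' : a =1 a' -> b =1 b' -> fps_mul a b =1 fps_mul a' b'.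
Proof. by move=> eqa eqb n; apply: eq_bigr => i _; rewrite eqa eqb. Qed.

Lemma fps_mulBl a b c :
  fps_mul (fps_sub a b) c =1 fps_sub (fps_mul a c) (fps_mul b c).
Proof.
by move=> n; rewrite /fps_sub /fps_mul -sumrB; apply: eq_bigr => i _; rewrite mulrBl.
Qed.

Lemma fps_mul1 a : fps_mul (@fps_one R) a =1 a.
Proof.
move=> n; rewrite /fps_mul big_ord_recl /fps_one mul1r subn0 big1 ?addr0 // => i _.
by rewrite mul0r.
Qed.

Lemma fps_mul_mulz a b : fps_mul a (fps_mulz b) =1 fps_mulz (fps_mul a b).
Proof.
case=> [|n]; first by rewrite /fps_mul big_ord1 mulr0.
rewrite /fps_mul big_ord_recr /= subnn mulr0 addr0.
by apply: eq_bigr => i _; rewrite subSn // -ltnS.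
Qed.

Lemma fps_mulZr (e : R) a b n :
  fps_mul a (fun m => e * b m) n = e * fps_mul a b n.
Proof. by rewrite /fps_mul mulr_sumr; apply: eq_bigr => i _; rewrite mulrCA. Qed.

(** Substituting dz for z is compatible with products, because the exponents of d add up to n in
    each term of the convolution. *)
Lemma fps_mul_rescale (d : R) a b n :
  fps_mul (fun m => d ^+ m * a m) (fun m => d ^+ m * b m) n
  = d ^+ n * fps_mul a b n.
Proof.
rewrite /fps_mul mulr_sumr; apply: eq_bigr => i _.
by rewrite mulrACA -exprD subnKC // -ltnS.
Qed.

End FpsMul.

Section FpsExp.
Variable F : fieldType.
Hypothesis charF0 : [pchar F] =i pred0.

Lemma natr_fact_neq0 m : (m`!%:R : F) != 0.
Proof. by rewrite ((pcharf0P F).1 charF0) -lt0n fact_gt0. Qed.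

Lemma natr_bin (n i : nat) : (i <= n)%N ->
  ('C(n, i)%:R : F) = n`!%:R / (i`!%:R * (n - i)`!%:R).
Proof.
move=> le_in; rewrite -(bin_fact le_in) !natrM mulfK //.
by rewrite mulf_neq0 ?natr_fact_neq0.
Qed.

Lemma fps_mul_exp (a b : F) : fps_mul (fps_exp a) (fps_exp b) =1 fps_exp (a + b).
Proof.
move=> n; rewrite /fps_exp addrC exprDn mulr_suml; apply: eq_bigr => i _.
have le_in : (i <= n)%N by rewrite -ltnS.
rewrite -[_ *+ 'C(_, _)]mulr_natr (natr_bin le_in).
by field; rewrite !natr_fact_neq0.
Qed.

Variables d x : F.
Variable beta : nat -> F.
Hypothesis betaE :
  fps_mul (fps_sub (fps_exp 1) (@fps_one F)) beta =1 fps_mulz (fps_exp x).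

(** This is [betaE] with z replaced by dz. The series [beta] stands for B_m(x)/m!, known only
    through its generating identity. *)
Lemma fps_mul_rescaled_bernoulli :
  fps_mul (fps_sub (fps_exp d) (@fps_one F)) (fun m => d ^+ m * beta m)
  =1 (fun m => d * fps_mulz (fps_exp (d * x)) m).
Proof.
have expdE : fps_sub (fps_exp d) (@fps_one F)
    =1 (fun m => d ^+ m * fps_sub (fps_exp 1) (@fps_one F) m).
  case=> [|m]; rewrite /fps_sub /fps_exp /fps_one ?expr0 ?mul1r //.
  by rewrite !subr0 expr1n mul1r.
move=> n; rewrite (eq_fps_mul expdE (fun=> erefl)) fps_mul_rescale betaE.
case: n => [|n] /=; first by rewrite !mulr0.
by rewrite /fps_exp exprMn exprS !mulrA.
Qed.

(** The second difference has generating function (e^((a+d)z) - e^(az)) (e^(dz) - 1), and the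
    Bernoulli series absorbs the second factor, leaving dz e^(dxz). That z accounts for index [n.+1]
    on the left against n on the right. *)
Lemma second_difference_mul_bernoulli (a : F) (n : nat) :
  fps_mul (fun k => ((a + d + d) ^+ k + a ^+ k - 2 * (a + d) ^+ k) / k`!%:R)
          (fun m => d ^+ m * beta m) n.+1
  = d * (((a + d + d * x) ^+ n - (a + d * x) ^+ n) / n`!%:R).
Proof.
pose H := fps_sub (fps_exp (a + d)) (fps_exp a).
pose E := fps_sub (fps_exp d) (@fps_one F).
have GE : (fun k => ((a + d + d) ^+ k + a ^+ k - 2 * (a + d) ^+ k) / k`!%:R)
    =1 fps_mul H E.
  move=> k; rewrite fps_mulC fps_mulBl /fps_sub fps_mul1 fps_mulC fps_mulBl.
  rewrite /fps_sub !fps_mul_exp /H /fps_sub /fps_exp.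
  by field; rewrite natr_fact_neq0.
rewrite (eq_fps_mul GE (fun=> erefl)) -fps_mulA.
rewrite (eq_fps_mul (fun=> erefl) fps_mul_rescaled_bernoulli) fps_mulZr.
rewrite fps_mul_mulz /= fps_mulBl /fps_sub !fps_mul_exp /fps_exp.
by rewrite mulrBl.
Qed.

End FpsExp.

Lemma sum_phi_bernoulli (F : fieldType) (charF0 : [pchar F] =i pred0)
    (x1 x2 x : F) (B : nat -> F) (n : nat) :
  x1 - x2 != 0 ->
  fps_mul (fps_sub (fps_exp 1) (@fps_one F)) (fun m => B m / m`!%:R)
    =1 fps_mulz (fps_exp x) ->
  \sum_(0 <= k < n.+2)
     'C(n.+1, k)%:R * (x1 - x2) ^ (n.+1%:Z - k%:Z - 1)
       * (2 ^+ k * phi k [:: x1; x2] - 2 * (x1 + x2) ^+ k) * B (n.+1 - k)%N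
  = n.+1%:R * ((x1 + x2 + (x1 - x2) * x) ^+ n
            - ((x1 - x2) * x + 2 * x2) ^+ n).
Proof.
move=> d_neq0 BE.
(* With a = 2 x2 and d = x1 - x2, the points a, a + d, a + 2d are 2 x2, x1 + x2, 2 x1. *)
have := second_difference_mul_bernoulli charF0 (x1 - x2) BE (2 * x2) n.
have -> : 2 * x2 + (x1 - x2) + (x1 - x2) = 2 * x1 by ring.
have -> : 2 * x2 + (x1 - x2) = x1 + x2 by ring.
rewrite /fps_mul; set d := x1 - x2 in d_neq0 *; set s := x1 + x2 => main.
(* The factorial turns 1/(k! (n+1-k)!) into a binomial coefficient, and 1/d lowers the exponent of d
   by one, giving d^(-1) at k = n+1. *)
transitivity (n.+1`!%:R / d *
  (d * (((s + d * x) ^+ n - (2 * x2 + d * x) ^+ n) / n`!%:R))).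
  rewrite -main big_mkord mulr_sumr; apply: eq_bigr => i _.
  have le_in : (i <= n.+1)%N by rewrite -ltnS.
  rewrite (natr_bin charF0 le_in) subzn // expfzDr // exprN1 -exprnP.
  rewrite /phi !big_cons big_nil addr0 !exprMn.
  by field; rewrite d_neq0 !natr_fact_neq0.
rewrite factS natrM [d * x + _]addrC.
by field; rewrite d_neq0 natr_fact_neq0.
Qed.

Section RatFun.
Variable K : fieldType.
Hypothesis charK0 : [pchar K] =i pred0.

(** Together with additivity, this lets characteristic zero and the Bernoulli identity pass from K
    to the field of rational functions. *)
Lemma ratfunC_is_monoid_morphism : monoid_morphism (@ratfunC K).
Proof.
by split=> [|a b]; rewrite /ratfunC ?mpolyC1 ?tofrac1 // mpolyCM tofracM.
Qed.

Lemma ratfunC_is_zmod_morphism : zmod_morphism (@ratfunC K).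
Proof. by move=> a b; rewrite /ratfunC mpolyCB tofracB. Qed.

HB.instance Definition _ :=
  GRing.isZmodMorphism.Build K (ratfun3 K) (@ratfunC K) ratfunC_is_zmod_morphism.
HB.instance Definition _ :=
  GRing.isMonoidMorphism.Build K (ratfun3 K) (@ratfunC K)
    ratfunC_is_monoid_morphism.

Lemma pchar_ratfun3 : [pchar ratfun3 K] =i pred0.
Proof. by move=> p; rewrite (fmorph_pchar (@ratfunC K)) charK0. Qed.

Lemma ratfunX_sub_neq0 (i j : 'I_3) : i != j -> ratfunX K i - ratfunX K j != 0.
Proof.
move=> ne_ij; rewrite /ratfunX -tofracB tofrac_eq0 subr_eq0.
(* If the two indeterminates were equal, so would be their coefficients at the monomial [U_(i)],
   forcing i = j. *)
apply: contraNneq ne_ij => /(congr1 (mcoeff U_(i))).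
rewrite !mcoeffX eqxx => /eqP; rewrite eq_sym.
case: (altP (U_(j)%MM =P U_(i)%MM)) => [/eqP|_]; last by rewrite eq_sym oner_eq0.
by rewrite eq_mnm1 eq_sym.
Qed.

Lemma bernoulli_ratfun_genE (x : ratfun3 K) :
  fps_mul (fps_sub (fps_exp 1) (@fps_one (ratfun3 K)))
          (fun m => (map_poly (@ratfunC K) (bernoulli K m)).[x] / m`!%:R)
  =1 fps_mulz (fps_exp x).
Proof.
(* Evaluation at x after embedding the coefficients is a ring morphism, so it carries
   [bernoulli_genE] over coefficient by coefficient. *)
pose h : {rmorphism {poly K} -> ratfun3 K} := horner_eval x \o map_poly (@ratfunC K).
(* A morphism out of K[x], which is not a field, is only known to preserve inverses of units. *)
have uf m : (m`!%:R : {poly K}) \is a GRing.unit.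
  by rewrite -polyC_natr poly_unitE size_polyC coefC /= unitfE natr_fact_neq0.
have hdiv p m : h (p / m`!%:R) = h p / m`!%:R.
  by rewrite rmorphM rmorphV ?uf // rmorph_nat.
have hexp p m : h (fps_exp p m) = fps_exp (h p) m.
  by rewrite /fps_exp hdiv rmorphXn.
have hX : h 'X = x by rewrite /h /= map_polyX /horner_eval hornerX.
move=> n; have := congr1 h (bernoulli_genE charK0 n).
have -> : h (fps_mulz (fps_exp 'X) n) = fps_mulz (fps_exp x) n.
  by case: n => [|n]; rewrite /fps_mulz ?hexp ?hX ?rmorph0.
move=> <-; rewrite rmorph_sum; apply: eq_bigr => i _.
by rewrite [RHS]rmorphM hdiv /fps_sub rmorphB hexp rmorph1 /fps_one rmorph_nat.
Qed.

End RatFun.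

Theorem theorem11 (K : fieldType) (charK0 : [pchar K] =i pred0)
    (n : nat) (n_gt0 : (0 < n)%N) :
  let x1 : ratfun3 K := ratfunX K 0 in
  let x2 : ratfun3 K := ratfunX K 1 in
  let x : ratfun3 K := ratfunX K 2 in
  let B (m : nat) : ratfun3 K := (map_poly (@ratfunC K) (bernoulli K m)).[x] in
  \sum_(0 <= k < n.+1)
     'C(n, k)%:R * (x1 - x2) ^ (n%:Z - k%:Z - 1)
       * (2 ^+ k * phi k [:: x1; x2] - 2 * (x1 + x2) ^+ k) * B (n - k)%N
  = n%:R * ((x1 + x2 + (x1 - x2) * x) ^+ (n - 1)
            - ((x1 - x2) * x + 2 * x2) ^+ (n - 1)).
Proof.
move=> x1 x2 x B; case: n n_gt0 => // n _; rewrite subn1.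
apply: (sum_phi_bernoulli (pchar_ratfun3 charK0)).
  exact: ratfunX_sub_neq0.
exact: bernoulli_ratfun_genE.
Qed.
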